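(* Let $\mathcal{A}$ be an $m$-th order $n$-dimensional tensor. If $\mathcal{A}$ is positive definite, then $\mathcal{A}$ is a P-tensor. If $\mathcal{A}$ is positive semidefinite, then $\mathcal{A}$ is a P$_0$-tensor.
   Context: An $m$-th order $n$-dimensional tensor is a real array $\mathcal{A}=(a_{i_1\ldots i_m})$, $1\le i_1,\ldots,i_m\le n$ (not assumed symmetric). For $\mathbf{x}\in\mathbb{R}^n$, $\mathcal{A}\mathbf{x}^{m-1}\in\mathbb{R}^n$ is the vector with $i$-th entry $\sum_{i_2,\ldots,i_m=1}^n a_{i i_2\ldots i_m}x_{i_2}\cdots x_{i_m}$, and $\mathcal{A}\mathbf{x}^m=\sum_{i=1}^n x_i(\mathcal{A}\mathbf{x}^{m-1})_i$. $\mathcal{A}$ is positive definite if $\mathcal{A}\mathbf{x}^m>0$ for all nonzero $\mathbf{x}\in\mathbb{R}^n$, and positive semidefinite if $\mathcal{A}\mathbf{x}^m\ge 0$ for all $\mathbf{x}\in\mathbb{R}^n$. $\mathcal{A}$ is a P-tensor if for each nonzero $\mathbf{x}\in\mathbb{R}^n$ there is an index $i$ with $x_i^{m-1}(\mathcal{A}\mathbf{x}^{m-1})_i>0$; it is a P$_0$-tensor if for each nonzero $\mathbf{x}\in\mathbb{R}^n$ there is an index $i$ with $x_i\ne 0$ and $x_i^{m-1}(\mathcal{A}\mathbf{x}^{m-1})_i\ge 0$.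
   Formalization: The second implication (positive semidefinite implies P_0) is proved only for even order m; for odd order it is false, e.g. m=3, n=2, a_112=1, a_211=-1 has Ax^3=0 but fails P_0 at x=(1,-1). *)

(* Defs.v *)
From HB Require Import structures.
From mathcomp Require Import all_boot all_order all_algebra.
From mathcomp Require Import reals.

Set Implicit Arguments.
Unset Strict Implicit.
Unset Printing Implicit Defensive.

Import Order.TTheory GRing.Theory Num.Theory.
Local Open Scope ring_scope.

(* An array (a_{i_1 ... i_m}) is indexed by the m-tuples of indices. *)
Definition tensor (R : realType) (m n : nat) : Type :=
  {ffun m.-tuple 'I_n -> R}.

(* The order is written m.+1 below, since A x^(order - 1) needs an order at
   least 1; thus x_i^(order - 1) is x_i ^+ m. *)
Section TensorOfPositiveOrder.
Variables (R : realType) (m n : nat).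
Implicit Types (A : tensor R m.+1 n) (x : 'cV[R]_n).

(* The tuple t lists the trailing indices i_2, ..., i_{m+1}. *)
Definition tensor_apply A x : 'cV[R]_n :=
  \col_i \sum_(t : m.-tuple 'I_n) A [tuple of i :: t] * \prod_(j <- t) x j 0.

Definition tensor_form A x : R := \sum_(i < n) x i 0 * tensor_apply A x i 0.

Definition positive_definite A : Prop :=
  forall x, x != 0 -> 0 < tensor_form A x.

(* Meaningful for every order, but for odd order it only says that the form
   A x^order vanishes identically, which does not imply P0_tensor: the third
   order tensor in dimension 2 with A x^2 = (x_1 x_2, - x_1^2) has A x^3 = 0,
   while at x = (1, -1) both x_i^2 (A x^2)_i equal -1. *)
Definition positive_semidefinite A : Prop :=
  forall x, 0 <= tensor_form A x.

Definition P_tensor A : Prop :=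
  forall x, x != 0 ->
    exists i : 'I_n, 0 < x i 0 ^+ m * tensor_apply A x i 0.

Definition P0_tensor A : Prop :=
  forall x, x != 0 ->
    exists i : 'I_n, x i 0 != 0 /\ 0 <= x i 0 ^+ m * tensor_apply A x i 0.

End TensorOfPositiveOrder.

(* Main.v *)
(* The sum A x^(m+1) = \sum_i x_i (A x^m)_i is positive (nonnegative) only if
   some term with x_i != 0 is. When the order m+1 is even, x_i^m (A x^m)_i
   differs from that term by an even power of x_i, hence has the same sign.
   When it is odd, A x^(m+1) is an odd function of x, so a positive definite
   tensor exists only in dimension 0. *)
Require Import Defs.
From mathcomp Require Import all_boot all_order all_algebra.
From mathcomp Require Import reals.
Import Order.TTheory GRing.Theory Num.Theory.
Local Open Scope ring_scope.

Lemma sgr_exp_odd (R : realDomainType) (m : nat) (x : R) :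
  odd m -> Num.sg (x ^+ m) = Num.sg x.
Proof.
move=> m_odd; rewrite sgrX; case: (sgrP x) => _.
- by rewrite expr0n; case: m m_odd.
- exact: expr1n.
- by rewrite -signr_odd m_odd.
Qed.

Lemma exprM_odd_le0 (R : realDomainType) (m : nat) (x y : R) :
  odd m -> (x ^+ m * y <= 0) = (x * y <= 0).
Proof. by move=> m_odd; rewrite -sgr_le0 sgrM sgr_exp_odd // -sgrM sgr_le0. Qed.

Lemma exprM_odd_lt0 (R : realDomainType) (m : nat) (x y : R) :
  odd m -> (x ^+ m * y < 0) = (x * y < 0).
Proof. by move=> m_odd; rewrite -sgr_lt0 sgrM sgr_exp_odd // -sgrM sgr_lt0. Qed.

(** Each monomial of [tensor_apply A x] has [m] factors, each changing sign; the outer factor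
    [x i 0] contributes one more sign. *)
Lemma tensor_formN (R : realType) (m n : nat) (A : tensor R m.+1 n)
    (x : 'cV[R]_n) :
  tensor_form A (- x) = (-1) ^+ m.+1 * tensor_form A x.
Proof.
rewrite /tensor_form mulr_sumr; apply: eq_bigr => i _.
have -> : tensor_apply A (- x) i 0 = (-1) ^+ m * tensor_apply A x i 0.
  rewrite !mxE mulr_sumr; apply: eq_bigr => t _.
  under eq_bigr do rewrite mxE -mulN1r.
  rewrite big_split mulrCA; congr (_ * _).
  by rewrite big_const_seq count_predT size_tuple iter_mulr_1.
by rewrite mxE exprS mulN1r !mulNr mulrCA.
Qed.

(** A nonzero [x] would make the form positive at both [x] and [- x], where its values are
    opposite. *)
Lemma positive_definite_odd (R : realType) (m n : nat) (A : tensor R m.+1 n)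
    (x : 'cV[R]_n) :
  odd m.+1 -> positive_definite A -> x = 0.
Proof.
move=> odd_order posA; have [//|x_neq0] := eqVneq x 0.
have := posA (- x); rewrite oppr_eq0 => /(_ x_neq0).
by rewrite tensor_formN -signr_odd odd_order mulN1r oppr_gt0 ltNge ltW ?posA.
Qed.

Theorem proposition3p1 (R : realType) (m n : nat) (A : tensor R m.+1 n) :
  (positive_definite A -> P_tensor A) /\
  (~~ odd m.+1 -> positive_semidefinite A -> P0_tensor A).
Proof.
split=> [posA x x_neq0 | /= /negbNE m_odd psdA x x_neq0].
  have m_odd : odd m.
    apply: contraNT x_neq0 => m_even.
    by apply/eqP/(positive_definite_odd _ _ _ _ _ _ posA).
  (* If no index works, every term of the form is nonpositive, hence so is the sum. *)
  apply/existsP; apply: contraLR (posA x x_neq0) => /existsPn nposA.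
  rewrite -leNgt; apply: sumr_le0 => i _; have := nposA i.
  by rewrite -leNgt exprM_odd_le0.
(* If no index works, only the terms with [x i 0 != 0] are known to be negative; [i0] supplies one,
   making the sum strictly negative. *)
have [i0 xi0_neq0] : exists i, x i 0 != 0.
  apply/existsP; apply: contraNT x_neq0 => /existsPn x0.
  by apply/eqP/colP => i; rewrite mxE; apply/eqP/negbNE/x0.
suff /existsP[i /andP[]] : [exists i, (x i 0 != 0) &&
    (0 <= x i 0 ^+ m * tensor_apply A x i 0)] by exists i.
apply: contraLR (psdA x) => /existsPn negA.
have term_lt0 i : x i 0 != 0 -> x i 0 * tensor_apply A x i 0 < 0.
  move=> xi_neq0; have := negA i.
  by rewrite xi_neq0 /= -ltNge exprM_odd_lt0.
rewrite -ltNge /tensor_form (bigD1 i0) //= ltr_nwDl ?term_lt0 //.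
apply: sumr_le0 => i _; have [->|/term_lt0/ltW//] := eqVneq (x i 0) 0.
by rewrite mul0r.
Qed.
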